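(* For a fixed integer $a \ge 1$ and positive integers $d, n$, each of the following conditions is equivalent to $d \preccurlyeq_a n$ (and hence they are all equivalent to one another): (1) ($a$-cutting property) There exists a positive integer $k$ such that $ad = \left\lfloor \frac{an}{k} \right\rfloor$. (2) ($a$-covering property) There exists a positive integer $k$ such that $k[d, d+1/a) \supseteq [n, n+1/a)$, where both sides denote half-open intervals in $\mathbb{R}$. (3) ($a$-intersection property) There exists a positive integer $k$ such that $k[d, d+1/a) \cap [n, n+1/a) \ne \emptyset$. (4) ($a$-strong remainder property) There is a positive integer $k$ such that $n = dk + r$ where the remainder $r$ satisfies $0 \le r < \min\left(d, \frac{k}{a}\right)$. (5) ($a$-tipping-point property) The strict inequality $\left\lfloor \frac{n}{d} \right\rfloor > \left\lfloor \frac{n}{d + 1/a} \right\rfloor$ holds. (6) ($a$-reciprocal-duality property) The identity $ad = \left\lfloor \frac{an}{\lfloor n/d \rfloor} \right\rfloor$ holds; equivalently, $d \le \frac{n}{\lfloor n/d \rfloor} < d + \frac1a$.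
   Context: For positive integers $d, n$, one writes $d \preccurlyeq_1 n$ ($d$ is a floor quotient of $n$) if $d = \lfloor n/k \rfloor$ for some positive integer $k$. For an integer $a \ge 1$, $d$ is an $a$-floor quotient of $n$, written $d \preccurlyeq_a n$, if and only if $ad \preccurlyeq_1 an$. For a positive integer $k$ and an interval $I \subset \mathbb{R}$, $kI = \{kt : t \in I\}$. In condition (6), if $\lfloor n/d \rfloor = 0$ (i.e. $d > n$) the expressions are undefined and the condition is understood not to hold. *)

(* Defs.v *)
From mathcomp Require Import all_boot all_order all_algebra.
From mathcomp Require Import all_classical all_reals.
Set Implicit Arguments.
Unset Strict Implicit.
Unset Printing Implicit Defensive.
Import Order.TTheory GRing.Theory Num.Theory.
Local Open Scope classical_set_scope.
Local Open Scope ring_scope.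

Definition floor_quotient (d n : nat) : Prop :=
  exists k : nat, (0 < k)%N /\ d = (n %/ k)%N.

Definition a_floor_quotient (a d n : nat) : Prop :=
  floor_quotient (a * d) (a * n).

Definition scale_set (R : realType) (k : nat) (I : set R) : set R :=
  [set k%:R * t | t in I].

Definition unit_frac_itv (R : realType) (a d : nat) : set R :=
  `[d%:R, d%:R + 1 / a%:R[%classic.
Arguments unit_frac_itv : clear implicits.

Definition a_cutting (R : realType) (a d n : nat) : Prop :=
  exists k : nat, (0 < k)%N /\
    (a * d)%:Z = Num.floor ((a * n)%:R / k%:R : R).

Definition a_covering (R : realType) (a d n : nat) : Prop :=
  exists k : nat, (0 < k)%N /\
    unit_frac_itv R a n `<=` scale_set k (unit_frac_itv R a d).

Definition a_intersection (R : realType) (a d n : nat) : Prop :=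
  exists k : nat, (0 < k)%N /\
    scale_set k (unit_frac_itv R a d) `&` unit_frac_itv R a n !=set0.

Definition a_strong_remainder (R : realType) (a d n : nat) : Prop :=
  exists (k : nat) (r : int), [/\ (0 < k)%N,
    n%:Z = d%:Z * k%:Z + r,
    0 <= r &
    r%:~R < Num.min (d%:R : R) (k%:R / a%:R)].

Definition a_tipping_point (R : realType) (a d n : nat) : Prop :=
  Num.floor (n%:R / d%:R : R) > Num.floor (n%:R / (d%:R + 1 / a%:R) : R).

(* Division by zero is total in the library ([x / 0 = 0]), so the two
   reciprocal-duality conditions explicitly require a nonzero denominator. *)
Definition a_reciprocal_duality (R : realType) (a d n : nat) : Prop :=
  let q := Num.floor (n%:R / d%:R : R) in
  q != 0 /\ (a * d)%:Z = Num.floor ((a * n)%:R / q%:~R : R).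

Definition a_reciprocal_duality_ineq (R : realType) (a d n : nat) : Prop :=
  let q := Num.floor (n%:R / d%:R : R) in
  q != 0 /\ d%:R <= (n%:R / q%:~R : R) < d%:R + 1 / a%:R.

(* Main.v *)
Require Import Defs.
From mathcomp Require Import all_boot all_order all_algebra.
From mathcomp Require Import all_classical all_reals.
From mathcomp Require Import ring zify.

Import Order.TTheory GRing.Theory Num.Theory.
Local Open Scope ring_scope.

(** For k > 0, the equation ad = floor(an / k) says ad <= an / k < ad + 1.
    Clearing denominators, and cancelling a on the left, turns it into two
    inequalities between natural numbers,

      kd <= n   and   an < k(ad + 1),

    the predicate [cuts a d n k] below; [d] is an [a]-floor quotient of [n]
    exactly when some [k] cuts.  Each of the six conditions is read off from
    this predicate.

    Conditions (1)-(3) ask for a [k], and for each of them the admissible [k]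
    are exactly those that cut.  Divided by a, the second inequality is
    n < k(d + 1/a), so that [k] cuts when n lies in k[d, d + 1/a).  Both
    endpoints of the latter interval lie in (1/a)Z, and [n, n + 1/a) is a single
    cell of that grid, so it is covered as soon as it is met, and both happen
    when its left endpoint n is covered ([cuts_of_meet], [covering_of_cuts]).
    In (4), r = n - dk turns the two inequalities into 0 <= r < k/a, and the
    additional bound r < d forces k = floor(n / d).

    The last three conditions concern this q = floor(n / d).  The first
    inequality bounds [k] above by q, whereas the second persists when [k]
    grows; so if any [k] cuts, then q does ([exists_cuts]).  Hence the
    bound r < d in (4) excludes no [n]; condition (6) says that q cuts, and (5)
    too, because floor(n / (d + 1/a)) < q means n < q(d + 1/a). *)

(** * Cutting factors *)

Definition cuts (a d n k : nat) : bool :=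
  [&& 0 < k, k * d <= n & a * n < k * (a * d).+1]%N.

Lemma cutsE (a d n k : nat) : (0 < a)%N -> (0 < k)%N ->
  cuts a d n k = (a * d == a * n %/ k)%N.
Proof.
move=> a0 k0; rewrite /cuts k0 eqn_leq leq_divRL //.
rewrite -[(_ %/ _ <= _)%N]ltnS ltn_divLR // -mulnA leq_pmul2l //.
by rewrite [(d * k)%N]mulnC [(_.+1 * k)%N]mulnC.
Qed.

(** Increasing k preserves an < k(ad + 1), and floor(n / d) is the largest
    k with kd <= n. *)
Lemma exists_cuts (a d n : nat) : (0 < d)%N ->
  (exists k, cuts a d n k) <-> cuts a d n (n %/ d).
Proof.
move=> d0; split=> [[k /and3P[k0 kdn ank]]|]; last by exists (n %/ d)%N.
have le_kq : (k <= n %/ d)%N by rewrite leq_divRL.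
apply/and3P; split; first exact: leq_trans le_kq.
  exact: leq_divM.
by apply: leq_trans ank _; rewrite leq_mul2r le_kq orbT.
Qed.

Lemma a_floor_quotient_cuts (a d n : nat) : (0 < a)%N ->
  a_floor_quotient a d n <-> exists k, cuts a d n k.
Proof.
move=> a0; split=> [[k [k0 e]]|[k c]]; exists k; first by rewrite cutsE ?e.
have k0 : (0 < k)%N by case/and3P: c.
by split=> //; apply/eqP; rewrite -cutsE.
Qed.

(** * Real divisions and intervals *)

Lemma floor_divn (R : realType) (m k : nat) :
  Num.floor (m%:R / k%:R : R) = (m %/ k)%N%:Z.
Proof.
case: k => [|k]; first by rewrite invr0 mulr0 floor0 divn0.
apply/eqP; rewrite floor_eq ler_pdivlMr ?ltr0n // ltr_pdivrMr ?ltr0n //.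
rewrite [_ + 1]addrC -intS !pmulrn -!natrM ler_nat ltr_nat.
by rewrite leq_divM ltn_ceil.
Qed.

Lemma left_endpoint_in (R : realType) (a n : nat) : (0 < a)%N ->
  unit_frac_itv R a n n%:R.
Proof.
by move=> a0; rewrite /unit_frac_itv /= in_itv /= lexx ltrDl divr_gt0 ?ltr0n.
Qed.

Lemma lt_upper_endpoint (R : realType) (a d n k : nat) : (0 < a)%N ->
  (n%:R < k%:R * (d%:R + 1 / a%:R) :> R) = (a * n < k * (a * d).+1)%N.
Proof.
move=> a0; have a0R : 0 < a%:R :> R by rewrite ltr0n.
rewrite -(ltr_pM2l a0R) -(ltr_nat R) !natrM -natr1 natrM.
congr (_ < _); field; exact: lt0r_neq0.
Qed.

Lemma cuts_real (R : realType) (a d n k : nat) : (0 < a)%N ->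
  cuts a d n k = (0 < k)%N &&
    (k%:R * d%:R <= (n%:R : R) < k%:R * (d%:R + 1 / a%:R)).
Proof. by move=> a0; rewrite lt_upper_endpoint // -natrM ler_nat. Qed.

(** The right endpoints satisfy n + 1/a <= k(d + 1/a) because a times
    the strict inequality n < k(d + 1/a) is one between integers. *)
Lemma covering_of_cuts (R : realType) (a d n k : nat) : (0 < a)%N ->
  cuts a d n k ->
  (unit_frac_itv R a n `<=` scale_set k (unit_frac_itv R a d))%classic.
Proof.
move=> a0 /and3P[k0 kdn ank] x.
have a0R : 0 < a%:R :> R by rewrite ltr0n.
have k0R : 0 < k%:R :> R by rewrite ltr0n.
have endpoints : n%:R + 1 / a%:R <= k%:R * (d%:R + 1 / a%:R) :> R.
  have -> : n%:R + 1 / a%:R = (a * n).+1%:R / a%:R :> R.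
    by rewrite -natr1 natrM; field; exact: lt0r_neq0.
  have -> : k%:R * (d%:R + 1 / a%:R) = (k * (a * d).+1)%:R / a%:R :> R.
    by rewrite natrM -natr1 natrM; field; exact: lt0r_neq0.
  by rewrite ler_pM2r ?invr_gt0 // ler_nat.
rewrite /unit_frac_itv /scale_set /= !in_itv /= => /andP[nx xn].
exists (x / k%:R); last by rewrite mulrC divfK ?lt0r_neq0.
rewrite in_itv /= ler_pdivlMr // ltr_pdivrMr // mulrC -natrM.
rewrite [X in _ && (_ < X)]mulrC (lt_le_trans xn endpoints) andbT.
by apply: le_trans nx; rewrite ler_nat.
Qed.

(** A common point is below n + 1/a <= n + 1 and at least kd, hence kd <= n
    by integrality. *)
Lemma cuts_of_meet (R : realType) (a d n k : nat) :
  (0 < a)%N -> (0 < k)%N ->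
  (scale_set k (unit_frac_itv R a d) `&` unit_frac_itv R a n !=set0)%classic ->
  cuts a d n k.
Proof.
move=> a0 k0 [_ [[t + <-]]].
have k0R : 0 < k%:R :> R by rewrite ltr0n.
rewrite /unit_frac_itv /= !in_itv /= => /andP[dt td] /andP[nt tn].
rewrite /cuts k0 -(lt_upper_endpoint R) //=; apply/andP; split.
- rewrite -ltnS -(ltr_nat R) -natr1 natrM.
  have a1 : 1 / a%:R <= 1 :> R by rewrite ler_pdivrMr ?ltr0n // mul1r ler1n.
  apply: le_lt_trans (lt_le_trans tn _); first by rewrite ler_pM2l.
  by rewrite lerD2l.
- by apply: le_lt_trans nt _; rewrite ltr_pM2l.
Qed.

(** * The six conditions *)

Lemma a_cutting_cuts (R : realType) (a d n : nat) : (0 < a)%N ->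
  a_cutting R a d n <-> exists k, cuts a d n k.
Proof.
move=> a0; rewrite -a_floor_quotient_cuts //.
split=> -[k [k0 e]]; exists k; split=> //; last by rewrite floor_divn e.
by move: e; rewrite floor_divn => -[].
Qed.

Lemma a_covering_cuts (R : realType) (a d n : nat) : (0 < a)%N ->
  a_covering R a d n <-> exists k, cuts a d n k.
Proof.
move=> a0; split=> [[k [k0 cover]]|[k c]]; exists k; last first.
  by split; [case/and3P: c | exact: covering_of_cuts].
apply: (@cuts_of_meet R) => //; exists n%:R.
have nI := left_endpoint_in R a n a0.
by split=> //; exact: cover.
Qed.

Lemma a_intersection_cuts (R : realType) (a d n : nat) : (0 < a)%N ->
  a_intersection R a d n <-> exists k, cuts a d n k.
Proof.
move=> a0; split=> [[k [k0 meet]]|[k c]]; exists k.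
  exact: (@cuts_of_meet R).
split; first by case/and3P: c.
have nI := left_endpoint_in R a n a0.
by exists n%:R; split=> //; exact: covering_of_cuts c _ nI.
Qed.

(** The remainder bounded by both d and k/a is that of the Euclidean division
    of n by d. *)
Lemma a_strong_remainder_cuts (R : realType) (a d n : nat) :
  (0 < a)%N -> (0 < d)%N ->
  a_strong_remainder R a d n <-> exists k, cuts a d n k.
Proof.
move=> a0 d0; have a0R : 0 < a%:R :> R by rewrite ltr0n.
have lt_kVa (r k : nat) : (r%:R < k%:R / a%:R :> R) = (a * r < k)%N.
  by rewrite ltr_pdivlMr // -natrM ltr_nat mulnC.
split=> [[k [[r|r] [k0 nE // r0]]]|].
  rewrite lt_min -pmulrn lt_kVa => /andP[_ ark].
  have {}nE : n = (d * k + r)%N by lia.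
  by exists k; apply/and3P; split=> //; rewrite nE; nia.
rewrite exists_cuts // => /and3P[q0 _ anq].
exists (n %/ d)%N, (n %% d)%N%:Z; have nE := divn_eq n d; split=> //.
  by rewrite [in LHS]nE mulnC PoszD PoszM.
rewrite lt_min -pmulrn ltr_nat ltn_mod d0 lt_kVa.
by move: anq; rewrite [X in (a * X < _)%N]nE; nia.
Qed.

(** As n / (d + 1/a) = an / (ad + 1), its floor is a quotient of naturals,
    and it is below q iff an < q(ad + 1). *)
Lemma a_tipping_point_cuts (R : realType) (a d n : nat) :
  (0 < a)%N -> (0 < d)%N ->
  a_tipping_point R a d n <-> exists k, cuts a d n k.
Proof.
move=> a0 d0; have a0R : 0 < a%:R :> R by rewrite ltr0n.
rewrite exists_cuts // /a_tipping_point /cuts leq_divM /=.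
have -> : n%:R / (d%:R + 1 / a%:R) = (a * n)%:R / (a * d).+1%:R :> R.
  rewrite -natr1 !natrM; field.
  by rewrite -natrM natr1 pnatr_eq0 /= lt0r_neq0.
rewrite !floor_divn ltz_nat ltn_divLR //.
by split=> [lt|/andP[]//]; rewrite lt andbT; case: (n %/ d)%N lt.
Qed.

Lemma a_reciprocal_duality_cuts (R : realType) (a d n : nat) :
  (0 < a)%N -> (0 < d)%N ->
  a_reciprocal_duality R a d n <-> exists k, cuts a d n k.
Proof.
move=> a0 d0; rewrite exists_cuts // /a_reciprocal_duality /= floor_divn.
rewrite -pmulrn floor_divn; split=> [[q0 [e]]|c].
  by rewrite cutsE // ?lt0n //; exact/eqP.
have q0 : (0 < n %/ d)%N by case/and3P: c.
by split; [rewrite -lt0n | move: c; rewrite cutsE // => /eqP->].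
Qed.

Lemma a_reciprocal_duality_ineq_cuts (R : realType) (a d n : nat) :
  (0 < a)%N -> (0 < d)%N ->
  a_reciprocal_duality_ineq R a d n <-> exists k, cuts a d n k.
Proof.
move=> a0 d0; rewrite exists_cuts // /a_reciprocal_duality_ineq /= floor_divn.
rewrite -pmulrn (cuts_real R) // eqz_nat -lt0n.
case: ltnP => [q0|_] /=; last by split=> [[]|].
rewrite ler_pdivlMr ?ltr0n // ltr_pdivrMr ?ltr0n //.
rewrite mulrC [X in _ && (_ < X)]mulrC.
by split=> [[]|].
Qed.

Theorem theorem3p1 (R : realType) (a d n : nat)
    (ha : (1 <= a)%N) (hd : (0 < d)%N) (hn : (0 < n)%N) :
  (a_floor_quotient a d n <-> a_cutting R a d n) /\
  (a_floor_quotient a d n <-> a_covering R a d n) /\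
  (a_floor_quotient a d n <-> a_intersection R a d n) /\
  (a_floor_quotient a d n <-> a_strong_remainder R a d n) /\
  (a_floor_quotient a d n <-> a_tipping_point R a d n) /\
  (a_floor_quotient a d n <-> a_reciprocal_duality R a d n) /\
  (a_floor_quotient a d n <-> a_reciprocal_duality_ineq R a d n).
Proof.
rewrite a_floor_quotient_cuts // a_cutting_cuts // a_covering_cuts //.
rewrite a_intersection_cuts // a_strong_remainder_cuts //.
rewrite a_tipping_point_cuts // a_reciprocal_duality_cuts //.
by rewrite a_reciprocal_duality_ineq_cuts.
Qed.
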